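(* (1) Let $\Omega\subset\mathbb{R}^2$ be a domain and $\Phi:\Omega\to\mathbb{R}$ a convex potential. Then $\Phi$ satisfies the WDVV equations $$\sum_{p,q}\Phi^{pq}\Phi_{jlp}\Phi_{ikq}=\sum_{p,q}\Phi^{pq}\Phi_{ilp}\Phi_{jkq}\qquad\text{for all } i,j,k,l$$ if and only if it satisfies the single equation $$\sum_{i,j,k,l,p,q}\Phi^{jl}\Phi^{ik}\Phi^{pq}\Phi_{jlp}\Phi_{ikq}=\sum_{i,j,k,l,p,q}\Phi_{ilp}\Phi_{jkq}\Phi^{pq}\Phi^{jl}\Phi^{ik}.$$ (2) Let $\Omega\subset\mathbb{R}^3$ be a domain and $\Phi:\Omega\to\mathbb{R}$ a convex potential. Then $\Phi$ satisfies the WDVV equations displayed in (1) (with indices now in $\{1,2,3\}$) if and only if it satisfies the six equations (indexed symmetrically in $i$ and $k$) $$\sum_{j,l,p,q}\Phi^{jl}\Phi^{pq}\Phi_{jlp}\Phi_{ikq}=\sum_{j,l,p,q}\Phi_{ilp}\Phi_{jkq}\Phi^{pq}\Phi^{jl}.$$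
   Context: A convex potential is a smooth function with positive definite Hessian everywhere on $\Omega$. For a multi-index $J$, $\Phi_J$ denotes the corresponding partial derivative of $\Phi$ in the standard coordinates, and $\Phi^{ij}$ denotes the $(i,j)$ entry of the inverse of the Hessian matrix $(\Phi_{\alpha\beta})$. All equations are required to hold at every point of $\Omega$; all indices range over $\{1,\dots,n\}$ where $\Omega\subset\mathbb{R}^n$. *)

(* Defs.v *)
From mathcomp Require Import all_boot all_order all_algebra.
From mathcomp Require Import all_classical all_reals all_analysis.

Set Implicit Arguments.
Unset Strict Implicit.
Unset Printing Implicit Defensive.

Import Order.TTheory GRing.Theory Num.Theory.
Import numFieldNormedType.Exports.

Local Open Scope classical_set_scope.
Local Open Scope ring_scope.

(* A function Omega -> R is encoded as a total function on R^n.  Only its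
   restriction to Omega matters below: Omega is open, and derivatives are only
   ever taken at points of Omega. *)

Definition is_domain (R : realType) (n : nat) (Omega : set 'rV[R]_n) : Prop :=
  [/\ Omega !=set0, open Omega & connected Omega].

(* [pderivs [:: i; j; k] f] is d_i (d_j (d_k f)).  'D_v returns an unspecified
   value where the limit does not exist; [smooth_on] rules this out. *)
Definition pderivs (R : realType) (n : nat) (J : seq 'I_n)
    (f : 'rV[R]_n -> R) : 'rV[R]_n -> R :=
  foldr (fun (i : 'I_n) (g : 'rV[R]_n -> R) => 'D_(delta_mx 0 i) g) f J.

Definition smooth_on (R : realType) (n : nat) (Omega : set 'rV[R]_n)
    (f : 'rV[R]_n -> R) : Prop :=
  forall (J : seq 'I_n) (x : 'rV[R]_n), Omega x ->
    {for x, continuous (pderivs J f)} /\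
    (forall i : 'I_n, derivable (pderivs J f) x (delta_mx 0 i)).

Definition hessian (R : realType) (n : nat) (f : 'rV[R]_n -> R)
    (x : 'rV[R]_n) : 'M[R]_n :=
  \matrix_(i < n, j < n) pderivs [:: i; j] f x.

(* Symmetry is not demanded: a Hessian of a smooth function is symmetric. *)
Definition posdefmx (R : realType) (n : nat) (A : 'M[R]_n) : Prop :=
  forall v : 'rV[R]_n, v != 0 -> 0 < (v *m A *m v^T) 0 0.

Definition convex_potential (R : realType) (n : nat) (Omega : set 'rV[R]_n)
    (Phi : 'rV[R]_n -> R) : Prop :=
  smooth_on Omega Phi /\
  (forall x : 'rV[R]_n, Omega x -> posdefmx (hessian Phi x)).

Definition d3 (R : realType) (n : nat) (Phi : 'rV[R]_n -> R)
    (x : 'rV[R]_n) (i j k : 'I_n) : R :=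
  pderivs [:: i; j; k] Phi x.

Definition hinv (R : realType) (n : nat) (Phi : 'rV[R]_n -> R)
    (x : 'rV[R]_n) (i j : 'I_n) : R :=
  invmx (hessian Phi x) i j.

Definition WDVV (R : realType) (n : nat) (Omega : set 'rV[R]_n)
    (Phi : 'rV[R]_n -> R) : Prop :=
  forall x : 'rV[R]_n, Omega x -> forall i j k l : 'I_n,
    \sum_(p < n) \sum_(q < n)
      hinv Phi x p q * d3 Phi x j l p * d3 Phi x i k q =
    \sum_(p < n) \sum_(q < n)
      hinv Phi x p q * d3 Phi x i l p * d3 Phi x j k q.

(* Main.v *)
Require Import Defs.
From mathcomp Require Import all_boot all_order all_algebra.
From mathcomp Require Import all_classical all_reals all_analysis.
From mathcomp Require Import ring.

(** The WDVV equations say that the tensor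
      W_ijkl = sum_pq Phi^pq (Phi_jlp Phi_ikq - Phi_ilp Phi_jkq)
    vanishes.  Up to a constant factor W is the Riemann curvature tensor of the
    Hessian metric g = Phi_ij; no fourth derivatives occur because they cancel
    in the curvature of such a metric.  The equations to which WDVV is reduced
    say that the scalar curvature (n = 2), respectively the Ricci tensor
    (n = 3), of W vanishes.  So the theorem is the classical fact that in
    dimension two, respectively three, the curvature is determined by its
    scalar, respectively Ricci, contraction, and it is proved pointwise by
    linear algebra.

    Write h for the matrix of the Phi^ij.  Two antisymmetries, W_jikl = - W_ijkl
    and W_ijlk = - W_ijkl, follow from the symmetry of h
    ([wdvv_defect_alternating]).
    - In dimension two they leave one component, and
      scalar_curvature = 2 det h W_0101  ([scalar_curvature2]).
    - In dimension three, W_ijkl = sum_ab eps_ija eps_klb E_ab for a matrix E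
      ([hodge]).  Then Ric is the differential of the cofactor matrix at h in
      the direction E, that is, Ric^T = det h (tr(h^-1 E) h^-1 - h^-1 E h^-1).
      Solving for E gives 2 det h E = tr(h Ric^T) h - 2 h Ric^T h
      ([hodge_ricci]), so Ric = 0 forces E = 0.
    In both cases det h is nonzero because the Hessian is positive definite.
    As the six Ricci equations are indexed by i <= k only, the symmetry of Ric
    is needed as well ([ricci_wdvv_defect_sym]); it comes from the symmetry of h
    and the total symmetry of Phi_ijk.

    The symmetry of h and of Phi_ijk rests on the interchange of partial
    derivatives ([mixed_derivative_sym]), proved here for directional
    derivatives of a real function on a normed space: the second difference of
    f over a small parallelogram is, by two uses of the mean value theorem, a
    value of either mixed derivative near the base point. *)

Set Implicit Arguments.
Unset Strict Implicit.
Unset Printing Implicit Defensive.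

Import Order.TTheory GRing.Theory Num.Theory.
Import numFieldNormedType.Exports.

Local Open Scope classical_set_scope.
Local Open Scope ring_scope.

(** * Interchange of directional derivatives *)

Section MixedDerivatives.
Context {R : realType} {V : normedModType R}.
Implicit Types (f : V -> R) (u v x a : V) (s t r : R).

Lemma is_derive_line f u a s : derivable f (s *: u + a) u ->
  is_derive s 1 (fun r => f (r *: u + a)) ('D_u f (s *: u + a)).
Proof.
(* Both derivatives are limits of the same difference quotient. *)
pose q1 := fun h : R => h^-1 *: (f (h *: u + (s *: u + a)) - f (s *: u + a)).
pose q2 := fun h : R => h^-1 *: (f ((h *: (1 : R) + s) *: u + a) - f (s *: u + a)).
have qE : q1 = q2.
  apply/funext => h; rewrite /q1 /q2; congr (_ *: (f _ - _)).
  by rewrite addrA -scalerDl [h *: _]mulr1.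
have dE : derivable (fun r : R => f (r *: u + a)) s 1 = derivable f (s *: u + a) u.
  by rewrite /derivable -/q1 -/q2 qE.
have DE : 'D_1 (fun r : R => f (r *: u + a)) s = 'D_u f (s *: u + a).
  by rewrite /derive -/q1 -/q2 qE.
by move=> df; split; rewrite ?dE ?DE.
Qed.

Lemma mean_value0 (g dg : R -> R) t : 0 < t ->
  (forall s, 0 <= s <= t -> is_derive s 1 g (dg s)) ->
  exists2 s, 0 <= s <= t & g t - g 0 = t * dg s.
Proof.
move=> t_gt0 gdg.
have gc : {within `[0, t], continuous g}.
  apply: derivable_within_continuous => s; rewrite in_itv /= => /gdg.
  by case.
have gi s : s \in `]0, t[ -> is_derive s 1 g (dg s).
  by rewrite in_itv /= => /andP[s0 st]; apply: gdg; rewrite !ltW.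
have [c] := MVT t_gt0 gi gc; rewrite in_itv /= => /andP[c0 ct] ->.
by exists c; rewrite ?ltW// subr0 mulrC.
Qed.

(** The difference of f between two opposite sides of the parallelogram is a
    function of the position along u, to which the mean value theorem applies;
    its derivative is the increment of D_u f along v, to which it applies
    again. *)
Lemma second_difference f u v x t : 0 < t ->
  (forall s r, 0 <= s <= t -> 0 <= r <= t ->
    derivable f (s *: u + (r *: v + x)) u /\
    derivable ('D_u f) (s *: u + (r *: v + x)) v) ->
  exists s r, [/\ 0 <= s <= t, 0 <= r <= t &
    f (t *: u + (t *: v + x)) - f (t *: u + x) - f (t *: v + x) + f x =
    t * (t * 'D_v ('D_u f) (s *: u + (r *: v + x)))].
Proof.
move=> t_gt0 df.
have t0 : 0 <= (0 : R) <= t by rewrite lexx ltW.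
have tt : 0 <= t <= t by rewrite lexx ltW.
pose g s := f (s *: u + (t *: v + x)) - f (s *: u + x).
pose dg s := 'D_u f (s *: u + (t *: v + x)) - 'D_u f (s *: u + x).
have g_dg s : 0 <= s <= t -> is_derive s 1 g (dg s).
  move=> s0t; apply: is_deriveB; apply: is_derive_line.
    by have [] := df s t s0t tt.
  by have [] := df s 0 s0t t0; rewrite scale0r add0r.
have [s s0t gE] := mean_value0 t_gt0 g_dg.
pose h r := 'D_u f (r *: v + (s *: u + x)).
pose dh r := 'D_v ('D_u f) (r *: v + (s *: u + x)).
have h_dh r : 0 <= r <= t -> is_derive r 1 h (dh r).
  move=> r0t; apply: is_derive_line; rewrite addrCA.
  by have [] := df s r s0t r0t.
have [r r0t hE] := mean_value0 t_gt0 h_dh.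
exists s, r; split => //; rewrite [s *: u + _]addrCA -/(dh r) -hE.
rewrite /h scale0r add0r [t *: v + (s *: u + x)]addrCA -/(dg s) -gE /g !scale0r !add0r.
by ring.
Qed.

(** The second difference is symmetric in u and v, so on every small
    parallelogram at x both mixed derivatives take a common value; by
    continuity their values at x are arbitrarily close. *)
Lemma mixed_derivative_sym f u v x :
  (\forall y \near x, [/\ derivable f y u, derivable f y v,
     derivable ('D_u f) y v & derivable ('D_v f) y u]) ->
  {for x, continuous ('D_v ('D_u f))} ->
  {for x, continuous ('D_u ('D_v f))} ->
  'D_v ('D_u f) x = 'D_u ('D_v f) x.
Proof.
move=> fx cvu cuv; apply/eqP; rewrite -subr_eq0 -normr_le0.
apply/ler_addgt0Pl => e e_gt0; rewrite addr0.
have e2_gt0 : 0 < e / 2 by rewrite divr_gt0.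
have near_vu : \forall y \near x,
    `|'D_v ('D_u f) x - 'D_v ('D_u f) y| < e / 2.
  by move/cvgr_dist_lt : cvu; apply.
have near_uv : \forall y \near x,
    `|'D_u ('D_v f) x - 'D_u ('D_v f) y| < e / 2.
  by move/cvgr_dist_lt : cuv; apply.
have /nbhs_normP[d /= d_gt0 dP] : \forall y \near x,
    [/\ derivable f y u, derivable f y v,
        derivable ('D_u f) y v & derivable ('D_v f) y u] /\
    (`|'D_v ('D_u f) x - 'D_v ('D_u f) y| < e / 2 /\
     `|'D_u ('D_v f) x - 'D_u ('D_v f) y| < e / 2).
  exact (filterI fx (filterI near_vu near_uv)).
(* The 1 keeps K positive when u = v = 0. *)
pose K := `|u| + `|v| + 1.
have K_gt0 : 0 < K by rewrite ltr_wpDl// addr_ge0.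
pose t := d / (2 * K).
have t_gt0 : 0 < t by rewrite divr_gt0// mulr_gt0.
have inball s r : 0 <= s <= t -> 0 <= r <= t ->
    ball_ Num.norm x d (s *: u + (r *: v + x)).
  move=> /andP[s0 st] /andP[r0 rt]; rewrite /ball_ /=.
  rewrite addrA opprD addrCA subrr addr0 normrN.
  apply: (le_lt_trans (ler_normD _ _)); rewrite !normrZ !ger0_norm//.
  apply: (@le_lt_trans _ _ (t * K)).
    by rewrite /K !mulrDr mulr1 ler_wpDr ?(ltW t_gt0)// lerD// ler_wpM2r.
  have -> : t * K = d / 2 by rewrite /t; field; rewrite gt_eqF.
  by rewrite ltr_pdivrMr// ltr_pMr// ltr1n.
have inball' s r : 0 <= s <= t -> 0 <= r <= t ->
    ball_ Num.norm x d (s *: v + (r *: u + x)).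
  by move=> s0t r0t; rewrite addrCA; exact: inball.
pose diff2 := f (t *: u + (t *: v + x)) - f (t *: u + x) - f (t *: v + x) + f x.
have [A diff2A nearA] : exists2 A : R, diff2 = t * (t * A) &
    `|'D_v ('D_u f) x - A| < e / 2.
  have [|s [r [s0t r0t E]]] := @second_difference f u v x t t_gt0.
    by move=> s r s0t r0t; have [[]] := dP _ (inball _ _ s0t r0t).
  have [_ [near_x _]] := dP _ (inball _ _ s0t r0t).
  by exists ('D_v ('D_u f) (s *: u + (r *: v + x))); [exact E|exact near_x].
have [B diff2B nearB] : exists2 B : R, diff2 = t * (t * B) &
    `|'D_u ('D_v f) x - B| < e / 2.
  have [|s [r [s0t r0t E]]] := @second_difference f v u x t t_gt0.
    by move=> s r s0t r0t; have [[]] := dP _ (inball' _ _ s0t r0t).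
  have [_ [_ near_x]] := dP _ (inball' _ _ s0t r0t).
  exists ('D_u ('D_v f) (s *: v + (r *: u + x))); last exact near_x.
  rewrite -E /diff2.
  by rewrite [t *: v + (t *: u + x)]addrCA; congr (_ + _); rewrite addrAC.
have tn0 : t != 0 by rewrite gt_eqF.
have AB : A = B by apply: (mulfI tn0); apply: (mulfI tn0); rewrite -diff2A.
rewrite AB in nearA; move: nearA nearB.
move: ('D_v ('D_u f) x) ('D_u ('D_v f) x) => a b nearA nearB.
by apply: (le_trans (ler_distD B _ _)); rewrite [e]splitr lerD// ltW// distrC.
Qed.

End MixedDerivatives.

(** * Determinants of order two and three *)

Lemma sum_ord2 (K : nmodType) (F : 'I_2 -> K) : \sum_(i < 2) F i = F 0 + F 1.
Proof.
rewrite !big_ord_recl big_ord0 addr0.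
by congr (F _ + F _); apply: val_inj.
Qed.

Lemma sum_ord3 (K : nmodType) (F : 'I_3 -> K) :
  \sum_(i < 3) F i = F 0 + F 1 + F 2.
Proof.
rewrite !big_ord_recl big_ord0 addr0 addrA.
by congr (F _ + F _ + F _); apply: val_inj.
Qed.

Lemma det_mx22 (K : comNzRingType) (h : 'M[K]_2) :
  \det h = h 0 0 * h 1 1 - h 0 1 * h 1 0.
Proof.
rewrite (expand_det_row _ 0) sum_ord2 /cofactor !det_mx11 !mxE /=.
have [-> ->] : lift 0 0 = 1 :> 'I_2 /\ lift 1 0 = 0 :> 'I_2.
  by split; apply: val_inj.
by rewrite !add0n expr0 expr1 mul1r mulN1r mulrN.
Qed.

Lemma det_mx33 (K : comNzRingType) (h : 'M[K]_3) :
  \det h = h 0 0 * (h 1 1 * h 2 2 - h 1 2 * h 2 1)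
         - h 0 1 * (h 1 0 * h 2 2 - h 1 2 * h 2 0)
         + h 0 2 * (h 1 0 * h 2 1 - h 1 1 * h 2 0).
Proof.
rewrite (expand_det_row _ 0) sum_ord3 /cofactor !det_mx22 !mxE /=.
have [-> ->] : lift 0 0 = 1 :> 'I_3 /\ lift 0 1 = 2 :> 'I_3.
  by split; apply: val_inj.
have [-> ->] : lift 1 0 = 0 :> 'I_3 /\ lift 1 1 = 2 :> 'I_3.
  by split; apply: val_inj.
have [-> ->] : lift 2 0 = 0 :> 'I_3 /\ lift 2 1 = 1 :> 'I_3.
  by split; apply: val_inj.
by rewrite !add0n expr0 expr1 sqrrN expr1n; ring.
Qed.

(** * Curvature tensors in dimensions two and three *)

Definition alternating_pairs (K : pzRingType) (n : nat)
    (W : 'I_n -> 'I_n -> 'I_n -> 'I_n -> K) : Prop :=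
  (forall i j k l, W j i k l = - W i j k l) /\
  (forall i j k l, W i j l k = - W i j k l).

(** Here h is the inverse metric. *)
Definition ricci (K : pzRingType) (n : nat) (h : 'M[K]_n)
    (W : 'I_n -> 'I_n -> 'I_n -> 'I_n -> K) (i k : 'I_n) : K :=
  \sum_(j < n) \sum_(l < n) h j l * W i j k l.

Definition scalar_curvature (K : pzRingType) (n : nat) (h : 'M[K]_n)
    (W : 'I_n -> 'I_n -> 'I_n -> 'I_n -> K) : K :=
  \sum_(i < n) \sum_(j < n) \sum_(k < n) \sum_(l < n)
    h j l * h i k * W i j k l.

Lemma alternating_diag (K : numDomainType) (n : nat)
    (W : 'I_n -> 'I_n -> 'I_n -> 'I_n -> K) :
  alternating_pairs W ->
  (forall i k l, W i i k l = 0) /\ (forall i j k, W i j k k = 0).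
Proof.
move=> [alt12 alt34]; split=> [i k l|i j k].
  by apply/eqP; rewrite -eqNr -alt12.
by apply/eqP; rewrite -eqNr -alt34.
Qed.

Lemma scalar_curvature2 (K : numDomainType) (h : 'M[K]_2)
    (W : 'I_2 -> 'I_2 -> 'I_2 -> 'I_2 -> K) :
  alternating_pairs W ->
  scalar_curvature h W = 2 * \det h * W 0 1 0 1.
Proof.
move=> altW; have [alt12 alt34] := altW; have [W12 W34] := alternating_diag altW.
rewrite /scalar_curvature !sum_ord2 !W12 !W34.
rewrite (alt12 0 1 1 0) (alt12 0 1 0 1) !(alt34 _ _ 0 1) det_mx22.
ring.
Qed.

Lemma scalar_flat2 (K : numDomainType) (h : 'M[K]_2)
    (W : 'I_2 -> 'I_2 -> 'I_2 -> 'I_2 -> K) i j k l :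
  alternating_pairs W -> \det h != 0 -> scalar_curvature h W = 0 ->
  W i j k l = 0.
Proof.
move=> altW det_h /eqP; rewrite scalar_curvature2// !mulf_eq0 (negPf det_h) orbF.
rewrite pnatr_eq0 /= => /eqP W0.
have [alt12 alt34] := altW; have [W12 W34] := alternating_diag altW.
have ord2 (a : 'I_2) : a = 0 \/ a = 1.
  by case: a => [[|[|//]] ?]; [left|right]; apply: val_inj.
case: (ord2 i) (ord2 j) (ord2 k) (ord2 l) => -> [] -> [] -> [] ->;
by rewrite ?W12 ?W34 // ?(alt12 0 1) ?(alt34 _ _ 0 1) W0 ?oppr0.
Qed.

(** The matrix E of W on bivectors, a bivector of 3-space being identified with
    a vector: indices add modulo 3, so that (a, a + 1, a + 2) is always an even
    permutation of (0, 1, 2) and no signs occur. *)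
Definition hodge (K : pzRingType) (W : 'I_3 -> 'I_3 -> 'I_3 -> 'I_3 -> K)
    (a b : 'I_3) : K := W (a + 1) (a + 2) (b + 1) (b + 2).

(** The formula 2 det h E = tr(h Ric^T) h - 2 h Ric^T h, entry by entry, which
    inverts the differential of the cofactor matrix at h.  Multiplied out it is
    a polynomial identity in the entries of h and the components of W. *)
Lemma hodge_ricci (K : numDomainType) (h : 'M[K]_3)
    (W : 'I_3 -> 'I_3 -> 'I_3 -> 'I_3 -> K) a b :
  alternating_pairs W ->
  2 * \det h * hodge W a b =
  (\sum_(i < 3) \sum_(k < 3) h i k * ricci h W i k) * h a b
  - 2 * \sum_(i < 3) \sum_(k < 3) h a k * ricci h W i k * h i b.
Proof.
move=> altW; have [alt12 alt34] := altW; have [W12 W34] := alternating_diag altW.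
have ord3 (e : 'I_3) : [\/ e = 0, e = 1 | e = 2].
  by case: e => [[|[|[|//]]] ?]; [constructor 1|constructor 2|constructor 3];
     apply: val_inj.
have a11 : 1 + 1 = 2 :> 'I_3 by exact: val_inj.
have a12 : 1 + 2 = 0 :> 'I_3 by exact: val_inj.
have a21 : 2 + 1 = 0 :> 'I_3 by exact: val_inj.
have a22 : 2 + 2 = 1 :> 'I_3 by exact: val_inj.
rewrite /hodge /ricci !sum_ord3 det_mx33 !W12 !W34.
rewrite !(alt12 0 1) !(alt12 0 2) !(alt12 1 2) !(alt34 _ _ 0 1).
rewrite !(alt34 _ _ 0 2) !(alt34 _ _ 1 2).
case: (ord3 a) (ord3 b) => -> [] ->; rewrite ?add0r ?a11 ?a12 ?a21 ?a22;
rewrite ?(alt12 0 2) ?(alt34 _ _ 0 2); ring.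
Qed.

Lemma ricci_flat3 (K : numDomainType) (h : 'M[K]_3)
    (W : 'I_3 -> 'I_3 -> 'I_3 -> 'I_3 -> K) i j k l :
  alternating_pairs W -> \det h != 0 -> (forall a b, ricci h W a b = 0) ->
  W i j k l = 0.
Proof.
move=> altW det_h ric0; have [alt12 alt34] := altW.
have [W12 W34] := alternating_diag altW.
have hodge0 a b : hodge W a b = 0.
  apply: (mulfI (_ : 2 * \det h != 0)); first by rewrite mulf_neq0// pnatr_eq0.
  rewrite hodge_ricci// mulr0 !big1 ?mul0r ?mulr0 ?subr0// => i' _.
    by rewrite big1// => k' _; rewrite ric0 mulr0 mul0r.
  by rewrite big1// => k' _; rewrite ric0 mulr0.
(* A pair of distinct indices is, up to order, the complement of the third. *)
have pair_compl (p q : 'I_3) : p != q ->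
    exists a, (p, q) = (a + 1, a + 2) \/ (q, p) = (a + 1, a + 2).
  by case: p q => [[|[|[|//]]] ?] [[|[|[|//]]] ?] // _;
     [exists 2 | exists 1 | exists 2 | exists 0 | exists 1 | exists 0];
     solve [by left; congr pair; apply: val_inj | by right; congr pair; apply: val_inj].
have [->//|/pair_compl[a ija]] := eqVneq i j.
have [->//|/pair_compl[b klb]] := eqVneq k l.
have := hodge0 a b; rewrite /hodge.
case: ija => -[<- <-]; case: klb => -[<- <-] //.
- by rewrite alt34 => /eqP; rewrite oppr_eq0 => /eqP.
- by rewrite alt12 => /eqP; rewrite oppr_eq0 => /eqP.
- by rewrite alt12 alt34 opprK.
Qed.

(** * The curvature tensor of a Hessian metric *)

Section PointwiseAlgebra.
Context {K : comPzRingType} {n : nat}.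
Implicit Types (h : 'M[K]_n) (c : 'I_n -> 'I_n -> 'I_n -> K).

Definition contraction h c (i j k l : 'I_n) : K :=
  \sum_(p < n) \sum_(q < n) h p q * c j l p * c i k q.

(** The curvature tensor of the Hessian metric with inverse h and third
    derivatives c, up to a constant factor. *)
Definition wdvv_defect h c (i j k l : 'I_n) : K :=
  contraction h c i j k l - contraction h c j i k l.

Definition totally_symmetric c : Prop :=
  (forall i j k, c i j k = c j i k) /\ (forall i j k, c i j k = c i k j).

Lemma contraction_swap h c i j k l : h^T = h ->
  contraction h c i j k l = contraction h c j i l k.
Proof.
move=> symh; rewrite /contraction exchange_big; apply: eq_bigr => p _.
by apply: eq_bigr => q _; rewrite -{1}symh mxE -!mulrA [c j l q * _]mulrC.
Qed.

Lemma contraction_pair h c i j k l : totally_symmetric c ->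
  contraction h c i j k l = contraction h c k l i j.
Proof.
move=> [sym12 _]; rewrite /contraction; apply: eq_bigr => p _.
by apply: eq_bigr => q _; rewrite (sym12 j) (sym12 i).
Qed.

Lemma wdvv_defect_alternating h c :
  h^T = h -> alternating_pairs (wdvv_defect h c).
Proof.
move=> symh; split=> i j k l; rewrite /wdvv_defect opprB//.
by rewrite contraction_swap// [X in _ - X]contraction_swap.
Qed.

(** A contraction of the pair symmetry W_ijkl = W_klij. *)
Lemma ricci_wdvv_defect_sym h c i k : h^T = h -> totally_symmetric c ->
  ricci h (wdvv_defect h c) i k = ricci h (wdvv_defect h c) k i.
Proof.
move=> symh symc; rewrite /ricci exchange_big /=.
apply: eq_bigr => l _; apply: eq_bigr => j _; rewrite -{1}symh mxE.
rewrite /wdvv_defect; congr (_ * (_ - _)); first by rewrite contraction_pair.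
by rewrite contraction_pair// contraction_swap.
Qed.

Lemma ricci_wdvv_defectE h c i k :
  ricci h (wdvv_defect h c) i k =
  \sum_(j < n) \sum_(l < n) \sum_(p < n) \sum_(q < n)
    h j l * h p q * c j l p * c i k q -
  \sum_(j < n) \sum_(l < n) \sum_(p < n) \sum_(q < n)
    c i l p * c j k q * h p q * h j l.
Proof.
rewrite /ricci -sumrB; apply: eq_bigr => j _; rewrite -sumrB.
apply: eq_bigr => l _; rewrite mulrBr /contraction !mulr_sumr.
congr (_ - _); apply: eq_bigr => p _; rewrite mulr_sumr;
  apply: eq_bigr => q _; ring.
Qed.

Lemma scalar_curvature_wdvv_defectE h c :
  scalar_curvature h (wdvv_defect h c) =
  \sum_(i < n) \sum_(j < n) \sum_(k < n) \sum_(l < n)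
    \sum_(p < n) \sum_(q < n)
      h j l * h i k * h p q * c j l p * c i k q -
  \sum_(i < n) \sum_(j < n) \sum_(k < n) \sum_(l < n)
    \sum_(p < n) \sum_(q < n)
      c i l p * c j k q * h p q * h j l * h i k.
Proof.
rewrite /scalar_curvature -sumrB; apply: eq_bigr => i _; rewrite -sumrB.
apply: eq_bigr => j _; rewrite -sumrB; apply: eq_bigr => k _; rewrite -sumrB.
apply: eq_bigr => l _; rewrite mulrBr /contraction !mulr_sumr.
congr (_ - _); apply: eq_bigr => p _; rewrite mulr_sumr;
  apply: eq_bigr => q _; ring.
Qed.

End PointwiseAlgebra.

(** * Convex potentials *)

Section Potentials.
Context {R : realType} {n : nat} {Omega : set 'rV[R]_n} {Phi : 'rV[R]_n -> R}.
Lemma pderivs_swap i j J x :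
  open Omega -> smooth_on Omega Phi -> Omega x ->
  pderivs (i :: j :: J) Phi x = pderivs (j :: i :: J) Phi x.
Proof.
move=> Oopen smPhi Ox.
apply: (@mixed_derivative_sym _ _ (pderivs J Phi) (delta_mx 0 j) (delta_mx 0 i)).
- have Onear : \forall y \near x, Omega y by exact: open_nbhs_nbhs.
  near=> y; have Oy : Omega y by near: y.
  split; first exact: (smPhi J y Oy).2.
  + exact: (smPhi J y Oy).2.
  + exact: (smPhi (j :: J) y Oy).2.
  + exact: (smPhi (i :: J) y Oy).2.
- exact: (smPhi (i :: j :: J) x Ox).1.
- exact: (smPhi (j :: i :: J) x Ox).1.
Unshelve. all: by end_near. Qed.

Lemma d3_totally_symmetric x :
  open Omega -> convex_potential Omega Phi -> Omega x ->
  totally_symmetric (d3 Phi x).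
Proof.
move=> Oopen [smPhi _] Ox; split=> i j k.
  exact: pderivs_swap.
(* Symmetry of the Hessian at x alone does not suffice: it is differentiated. *)
have Onear : \forall y \near x, Omega y by exact: open_nbhs_nbhs.
apply: (@near_eq_derive _ _ _ (pderivs [:: j; k] Phi) (pderivs [:: k; j] Phi)).
near=> y; have Oy : Omega y by near: y.
exact: pderivs_swap Oopen smPhi Oy.
Unshelve. all: by end_near. Qed.

Lemma inverse_hessian_sym x :
  open Omega -> convex_potential Omega Phi -> Omega x ->
  (invmx (hessian Phi x))^T = invmx (hessian Phi x).
Proof.
move=> Oopen [smPhi _] Ox; rewrite trmx_inv; congr invmx.
by apply/matrixP => i j; rewrite !mxE; exact: pderivs_swap.
Qed.

Lemma det_inverse_hessian_neq0 x :
  convex_potential Omega Phi -> Omega x -> \det (invmx (hessian Phi x)) != 0.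
Proof.
move=> [_ pdH] Ox; rewrite det_inv invr_eq0.
apply/det0P => -[v v0 vH]; have := pdH x Ox v v0.
by rewrite vH mul0mx mxE ltxx.
Qed.

End Potentials.

Lemma WDVV_defectP (R : realType) (n : nat) (Omega : set 'rV[R]_n)
    (Phi : 'rV[R]_n -> R) :
  WDVV Omega Phi <-> forall x, Omega x -> forall i j k l,
    wdvv_defect (invmx (hessian Phi x)) (d3 Phi x) i j k l = 0.
Proof.
by split=> wdvv x Ox i j k l; [apply/eqP; rewrite subr_eq0; apply/eqP|
  apply/eqP; rewrite -subr_eq0; apply/eqP]; exact: wdvv.
Qed.

Theorem proposition13 (R : realType) :
  (forall (Omega : set 'rV[R]_2) (Phi : 'rV[R]_2 -> R),
     is_domain Omega -> convex_potential Omega Phi ->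
     (WDVV Omega Phi <->
      forall x : 'rV[R]_2, Omega x ->
        \sum_(i < 2) \sum_(j < 2) \sum_(k < 2) \sum_(l < 2)
          \sum_(p < 2) \sum_(q < 2)
            hinv Phi x j l * hinv Phi x i k * hinv Phi x p q *
            d3 Phi x j l p * d3 Phi x i k q =
        \sum_(i < 2) \sum_(j < 2) \sum_(k < 2) \sum_(l < 2)
          \sum_(p < 2) \sum_(q < 2)
            d3 Phi x i l p * d3 Phi x j k q *
            hinv Phi x p q * hinv Phi x j l * hinv Phi x i k))
  /\
  (forall (Omega : set 'rV[R]_3) (Phi : 'rV[R]_3 -> R),
     is_domain Omega -> convex_potential Omega Phi ->
     (WDVV Omega Phi <->
      forall x : 'rV[R]_3, Omega x -> forall i k : 'I_3, (i <= k)%N ->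
        \sum_(j < 3) \sum_(l < 3) \sum_(p < 3) \sum_(q < 3)
          hinv Phi x j l * hinv Phi x p q * d3 Phi x j l p * d3 Phi x i k q =
        \sum_(j < 3) \sum_(l < 3) \sum_(p < 3) \sum_(q < 3)
          d3 Phi x i l p * d3 Phi x j k q * hinv Phi x p q * hinv Phi x j l)).
Proof.
split=> Omega Phi [_ Oopen _] potential; split.
- move=> /WDVV_defectP wdvv x Ox; apply/eqP; rewrite -subr_eq0.
  rewrite -scalar_curvature_wdvv_defectE; apply/eqP.
  rewrite /scalar_curvature big1// => i _; rewrite big1// => j _.
  by rewrite big1// => k _; rewrite big1// => l _; rewrite wdvv// mulr0.
- move=> flat; apply/WDVV_defectP => x Ox i j k l.
  apply: (@scalar_flat2 _ (invmx (hessian Phi x))).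
  + exact/wdvv_defect_alternating/(inverse_hessian_sym Oopen potential).
  + exact: (det_inverse_hessian_neq0 potential).
  + rewrite scalar_curvature_wdvv_defectE; apply/eqP; rewrite subr_eq0.
    by apply/eqP; exact: flat.
- move=> /WDVV_defectP wdvv x Ox i k _; apply/eqP; rewrite -subr_eq0.
  rewrite -ricci_wdvv_defectE; apply/eqP.
  rewrite /ricci big1// => j _; rewrite big1// => l _.
  by rewrite wdvv// mulr0.
- move=> ricci0; apply/WDVV_defectP => x Ox i j k l.
  have symh := inverse_hessian_sym Oopen potential Ox.
  have symc := d3_totally_symmetric Oopen potential Ox.
  apply: (@ricci_flat3 _ (invmx (hessian Phi x))).
  + exact: wdvv_defect_alternating.
  + exact: (det_inverse_hessian_neq0 potential).
  + have ric_le (a b : 'I_3) : (a <= b)%N ->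
        ricci (invmx (hessian Phi x))
          (wdvv_defect (invmx (hessian Phi x)) (d3 Phi x)) a b = 0.
      move=> ab; rewrite ricci_wdvv_defectE; apply/eqP; rewrite subr_eq0.
      by apply/eqP; exact: ricci0.
    move=> a b; have [/ric_le//|/ltnW/ric_le ba] := leqP a b.
    by rewrite ricci_wdvv_defect_sym.
Qed.
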